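(* Let $G$ be a group, $R$ a commutative $G$-graded ring with nonzero unity, $M$ a nonzero $G$-graded $R$-module, and $K$ a proper graded $R$-submodule of $M$. Then the following are equivalent. (1) $K$ is a graded special $r$-submodule of $M$. (2) $Rx\cap K=(K:_R M)x$ for all $x\in h(M)-T(M)$. (3) $(K:_R M)=(K:_R x)$ for all $x\in h(M)-T(M)$.
   Context: A commutative ring $R$ is $G$-graded if $R=\bigoplus_{g\in G}R_g$ with additive subgroups $R_g$ satisfying $R_gR_h\subseteq R_{gh}$; an $R$-module $M$ is $G$-graded if $M=\bigoplus_{g\in G}M_g$ with additive subgroups $M_g$ satisfying $R_gM_h\subseteq M_{gh}$. Put $h(R)=\bigcup_{g\in G}R_g$ and $h(M)=\bigcup_{g\in G}M_g$. An $R$-submodule $K$ of $M$ is graded if $K=\bigoplus_{g\in G}(K\cap M_g)$. Notation: $(K:_R M)=\{r\in R: rM\subseteq K\}$; $(K:_R x)=\{r\in R: rx\in K\}$ for $x\in M$; $Ann_R(x)=\{r\in R: rx=0\}$; $T(M)=\{x\in M: Ann_R(x)\neq\{0\}\}$; $h(M)-T(M)$ is the set difference; $(K:_R M)x=\{rx: r\in (K:_R M)\}$. A proper graded $R$-submodule $K$ of $M$ is a graded special $r$-submodule if whenever $a\in h(R)$ and $x\in h(M)$ satisfy $ax\in K$ and $Ann_R(x)=\{0\}$, then $a\in(K:_R M)$. *)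

(* Defs.v *)
From HB Require Import structures.
From mathcomp Require Import all_boot all_order all_algebra.
From mathcomp Require Import all_classical.

Set Implicit Arguments.
Unset Strict Implicit.
Unset Printing Implicit Defensive.

Import GRing.Theory.

Local Open Scope classical_set_scope.
Local Open Scope ring_scope.

(* [internal_direct_sum A B]: B is the internal direct sum of its additive
   subgroups A g.  Finiteness of the support is required explicitly because
   [\sum_(g \in setT) f g] is 0 by convention when f has infinite support. *)
Definition internal_direct_sum (I : choiceType) (V : zmodType)
    (A : I -> set V) (B : set V) : Prop :=
  [/\ forall g, zmod_closed [pred v in A g],
      forall g, A g `<=` B
    & forall v, B v ->
      exists! f : I -> V,
        [/\ forall g, A g (f g),
            finite_set [set g | f g != 0]
          & v = \sum_(g \in [set: I]) f g]].

Definition graded_ring (G : groupType) (R : comNzRingType)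
    (R_ : G -> set R) : Prop :=
  internal_direct_sum R_ [set: R] /\
  forall g h r s, R_ g r -> R_ h s -> R_ (g * h)%g (r * s).

Definition graded_module (G : groupType) (R : comNzRingType) (M : lmodType R)
    (R_ : G -> set R) (M_ : G -> set M) : Prop :=
  internal_direct_sum M_ [set: M] /\
  forall g h r m, R_ g r -> M_ h m -> M_ (g * h)%g (r *: m).

Definition homogeneous (G V : Type) (A : G -> set V) : set V :=
  \bigcup_(g in [set: G]) A g.

Definition graded_submodule (G : groupType) (R : comNzRingType)
    (M : lmodType R) (M_ : G -> set M) (K : set M) : Prop :=
  submod_closed [pred m in K] /\ internal_direct_sum (fun g => K `&` M_ g) K.

Section Colon.
Variables (R : comNzRingType) (M : lmodType R).
Implicit Types (K : set M) (x : M).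

Definition colon K : set R := [set r | forall m : M, K (r *: m)].

Definition colon_elt K x : set R := [set r | K (r *: x)].

Definition ann x : set R := [set r | r *: x = 0].

Definition torsion : set M := [set x | ann x <> [set 0]].

End Colon.

Arguments torsion {R} M.

Definition proper_graded_submodule (G : groupType) (R : comNzRingType)
    (M : lmodType R) (M_ : G -> set M) (K : set M) : Prop :=
  graded_submodule M_ K /\ K <> [set: M].

Definition graded_special_r_submodule (G : groupType) (R : comNzRingType)
    (M : lmodType R) (R_ : G -> set R) (M_ : G -> set M) (K : set M) : Prop :=
  proper_graded_submodule M_ K /\
  forall a x, homogeneous R_ a -> homogeneous M_ x ->
    K (a *: x) -> ann x = [set 0] -> colon K a.

(* Main.v *)
Require Import Defs.
From HB Require Import structures.
From mathcomp Require Import all_boot all_order all_algebra.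
From mathcomp Require Import all_classical.

(** Call a homogeneous [x] with zero annihilator torsion-free.  The equivalence
    of (2) and (3) is pointwise: when [ann x] is zero, [r |-> r *: x] is
    injective, so a scalar [r] is determined by [r *: x], and cancelling [x]
    turns the equality of subsets of [M] in (2) into the equality of ideals
    in (3).  That (3) implies (1) only restricts attention to homogeneous
    scalars.

    The content is the passage from homogeneous scalars, the only ones that
    (1) speaks of, to arbitrary ones.  Suppose [r *: x] lies in [K], with [x]
    torsion-free of degree [h], and let [r] be the sum of its components [r_g].
    Then [r_g *: x] has degree [g * h], and since [g |-> g * h] is a bijection
    of [G], these elements are exactly the homogeneous components of [r *: x].
    A graded submodule contains the components of its elements
    ([graded_submodule_component]), so each [r_g *: x] is in [K]; by (1) each
    [r_g] is in [colon K], and hence so is their sum [r]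
    ([special_r_colon_elt]). *)

Set Implicit Arguments.
Unset Strict Implicit.
Unset Printing Implicit Defensive.

Import GRing.Theory.

Local Open Scope classical_set_scope.
Local Open Scope ring_scope.

(** Finiteness of the support cannot be dropped: a sum with infinite support
    is 0 by convention, while [x] may be killed by all but finitely many of
    the scalars. *)
Lemma scaler_fsuml (I : choiceType) (R : pzRingType) (M : lmodType R)
    (f : I -> R) (x : M) :
  finite_set [set i | f i != 0] ->
  (\sum_(i \in [set: I]) f i) *: x = \sum_(i \in [set: I]) f i *: x.
Proof.
move=> finf.
have finf' : finite_set ([set: I] `&` f @^-1` [set~ 0]).
  by apply: sub_finite_set finf => i [_ /eqP].
rewrite scaler_suml [RHS](fsbigE (finite_support 0 [set: I] f))//.
  by apply: eq_bigl => i; rewrite in_setT.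
move=> i _; rewrite in_finite_support// => /negP; rewrite inE => nfi.
suff -> : f i = 0 by rewrite scale0r.
by apply: contrapT => fi; apply: nfi.
Qed.

Section Submodule.
Variables (R : comNzRingType) (M : lmodType R) (K : set M).
Hypothesis submodK : submod_closed [pred m in K].

Let K0 : K 0.
Proof. by case: submodK => /=; rewrite inE. Qed.

Let KD u v : K u -> K v -> K (u + v).
Proof.
case: submodK => _ KZD /mem_set Ku /mem_set Kv.
by have := KZD 1 u v Ku Kv; rewrite /= inE scale1r.
Qed.

Lemma colon_fsum (I : choiceType) (f : I -> R) :
  (forall i, colon K (f i)) -> colon K (\sum_(i \in [set: I]) f i).
Proof.
move=> Kf; apply: (big_ind (colon K)) => [m|r s Kr Ks m|i _] //.
  by rewrite scale0r.
by rewrite scalerDl; apply: KD.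
Qed.

End Submodule.

(** The decomposition inside [K] is also one inside [M], so uniqueness of the
    latter identifies the two. *)
Lemma graded_submodule_component (G : groupType) (R : comNzRingType)
    (M : lmodType R) (M_ : G -> set M) (K : set M) (f : G -> M) :
  internal_direct_sum M_ [set: M] -> graded_submodule M_ K ->
  (forall g, M_ g (f g)) -> finite_set [set g | f g != 0] ->
  K (\sum_(g \in [set: G]) f g) -> forall g, K (f g).
Proof.
move=> [_ _ decM] [_ [_ _ decK]] Mf finf Kf g.
have [k [[KMk fink sumk] _]] := decK _ Kf.
have [u [_ uniq_u]] := decM (\sum_(g \in [set: G]) f g) I.
have uf : u = f by apply: uniq_u.
have uk : u = k by apply: uniq_u; split=> // i; case: (KMk i).
by rewrite -uf uk; case: (KMk g).
Qed.

Lemma scale_torsion_free_inj (R : comNzRingType) (M : lmodType R) (x : M) :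
  ann x = [set 0] -> injective (fun r : R => r *: x).
Proof.
move=> annx r s rsx; apply/eqP; rewrite -subr_eq0; apply/eqP.
have : ann x (r - s) by rewrite /ann /= scalerBl rsx subrr.
by rewrite annx.
Qed.

(** Homogeneity of [x] is what lets the hypothesis on homogeneous scalars reach
    an arbitrary [r]: multiplying by [x] merely shifts degrees, so distinct
    components of [r] contribute to distinct components of [r *: x] and cannot
    cancel each other. *)
Lemma special_r_colon_elt (G : groupType) (R : comNzRingType) (M : lmodType R)
    (R_ : G -> set R) (M_ : G -> set M) (K : set M) (x : M) :
  graded_ring R_ -> graded_module R_ M_ ->
  graded_special_r_submodule R_ M_ K ->
  homogeneous M_ x -> ann x = [set 0] -> colon_elt K x `<=` colon K.
Proof.
move=> [[_ _ decR] _] [decM mulM] [[gradK _] specK] homx annx r Krx.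
have [h _ Mx] := homx.
have [c [[Rc finc sumc] _]] := decR r I.
have bij_h : bijective (fun g : G => (g * h)%g).
  by exists (fun g => (g * h^-1)%g); [exact: mulgK | exact: mulgVK].
(* The components of [r *: x], indexed by their own degree. *)
pose f g := c (g * h^-1)%g *: x.
have fh g : f (g * h)%g = c g *: x by rewrite /f mulgK.
have Mf g : M_ g (f g) by rewrite -{1}(mulgVK h g); apply: mulM.
have finf : finite_set [set g | f g != 0].
  apply: (sub_finite_set _ (finite_image (fun g => (g * h)%g) finc)) => g /= fg.
  exists (g * h^-1)%g; last by rewrite mulgVK.
  by apply: contra_neq fg => c0; rewrite /f c0 scale0r.
have sumf : r *: x = \sum_(g \in [set: G]) f g.
  rewrite (reindex_fsbigT _ _ bij_h); under eq_fsbigr do rewrite fh.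
  by rewrite sumc scaler_fsuml.
have Kf : forall g, K (f g).
  by apply: (graded_submodule_component decM gradK) => //; rewrite -sumf.
rewrite sumc; apply: colon_fsum => [|g]; first by case: gradK.
by apply: (specK _ x) => //; [exists g | rewrite -fh].
Qed.

Theorem theorem4p13 (G : groupType) (R : comNzRingType) (M : lmodType R)
    (R_ : G -> set R) (M_ : G -> set M) (K : set M)
    (gradR : graded_ring R_) (gradM : graded_module R_ M_)
    (M_neq0 : exists m : M, m != 0)
    (gradK : proper_graded_submodule M_ K) :
  [<-> graded_special_r_submodule R_ M_ K;
       forall x, (homogeneous M_ `\` torsion M) x ->
         [set r *: x | r in [set: R]] `&` K = [set r *: x | r in colon K];
       forall x, (homogeneous M_ `\` torsion M) x ->
         colon K = colon_elt K x].
Proof.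
tfae.
- move=> specK x [homx /contrapT annx]; apply/seteqP; split.
    move=> _ [[r _ <-] Krx]; exists r => //.
    exact: (special_r_colon_elt gradR gradM specK homx annx).
  by move=> _ [r Kr <-]; split; [exists r | exact: Kr].
- move=> eqK x xtf; have [_ /contrapT annx] := xtf.
  apply/seteqP; split=> r Kr; first exact: Kr.
  have : ([set r *: x | r in [set: R]] `&` K) (r *: x) by split; [exists r|].
  by rewrite eqK// => -[s Ks /(scale_torsion_free_inj annx) <-].
- move=> eqK; split=> // a x _ homx Kax annx.
  by rewrite (eqK x)//; split=> // tx; exact: tx.
Qed.
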